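(* Let $n\ge 1$ and $m\ge 0$ be integers, let $\lambda=(\lambda_1,\ldots,\lambda_{n+m})\in\mathbb R^{n+m}$ and $\bar\lambda=(\bar\lambda_1,\ldots,\bar\lambda_m)\in\mathbb R^m$ be weakly decreasing, and let $\mu,\nu\in\mathbb R^n$ be such that $|\lambda|-|\bar\lambda|+|\mu|-|\nu|=0$. Then a strip-concave trapezoidal array $X$ of size $(n,m)$ with $(\lambda^X,\bar\lambda^X,\mu^X,\nu^X)=(\lambda,\bar\lambda,\mu,\nu)$ exists if and only if the inequality $$\lambda[1,|I|]+\mu(I)-\nu(I)-\Delta_{|I|}\ge 0$$ holds for each (including empty) subset $I\subseteq\{1,\ldots,n\}$. Furthermore, if $\lambda,\bar\lambda,\mu,\nu$ are integer and the polytope $\mathcal{SC}(\lambda\setminus\bar\lambda,\mu,\nu)$ is nonempty, then it contains an integer point.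
   Context: Trapezoidal arrays. For integers $n\ge 1$, $m\ge 0$ let $V=\{(i,j)\in\mathbb Z^2: 0\le i\le n,\ 0\le j\le i+m\}$. A trapezoidal array of size $(n,m)$ is a real array $X=(x_{ij})_{(i,j)\in V}\in\mathbb R^V$. Its row derivative is given by $\partial x_{ij}:=x_{ij}-x_{i,j-1}$ for $0\le i\le n$, $1\le j\le i+m$. The array $X$ is strip-concave if for all $i=1,\ldots,n$: $\partial x_{ij}\ge \partial x_{i-1,j}$ for $1\le j\le i-1+m$, and $\partial x_{i-1,j}\ge\partial x_{i,j+1}$ for $1\le j\le i+m-1$. $\mathcal{SC}_V$ denotes the set of strip-concave arrays $X\in\mathbb R^V$ with the normalization $x_{00}=0$. Boundary tuples of $X$: $\lambda^X_j:=\partial x_{nj}$ ($j=1,\ldots,n+m$), $\bar\lambda^X_j:=\partial x_{0j}$ ($j=1,\ldots,m$; empty if $m=0$), $\mu^X_i:=x_{i0}-x_{i-1,0}$ and $\nu^X_i:=x_{i,i+m}-x_{i-1,i-1+m}$ ($i=1,\ldots,n$). $\mathcal{SC}(\lambda\setminus\bar\lambda,\mu,\nu):=\{X\in\mathcal{SC}_V:(\lambda^X,\bar\lambda^X,\mu^X,\nu^X)=(\lambda,\bar\lambda,\mu,\nu)\}$. An integer point is an array all of whose entries are integers. Notation: for a tuple $d=(d_p,\ldots,d_q)$, $|d|:=\sum_{i=p}^q d_i$; $d(I):=\sum_{i\in I}d_i$ for $I\subseteq\{p,\ldots,q\}$; $d[k,k']:=d_k+\cdots+d_{k'}$ (so $\lambda[1,0]=0$).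 ''Weakly decreasing'' means $d_p\ge d_{p+1}\ge\cdots\ge d_q$. Deficits: for $k\in\mathbb Z_{\ge 0}$ and $j=1,\ldots,n+m$, $\delta_k(j):=\max\{0,\bar\lambda_{j-k}-\lambda_j\}$ if $1\le j-k\le m$, and $\delta_k(j):=0$ otherwise; $\Delta_k:=\sum_{j=1}^{n+m}\delta_k(j)$. *)

(* Defs.v *)
From HB Require Import structures.
From mathcomp Require Import all_boot all_order all_algebra.
From mathcomp Require Import classical_sets reals.

Set Implicit Arguments.
Unset Strict Implicit.
Unset Printing Implicit Defensive.

Import Order.TTheory GRing.Theory Num.Theory.
Local Open Scope ring_scope.

(* Tuples (d_1, ..., d_N) are row vectors, whose coordinates are numbered from
   0; [tcoord d j] is d_j for 1 <= j <= N, and a dummy 0 for any other j. *)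
Definition tcoord (R : realType) (N : nat) (d : 'rV[R]_N) (j : nat) : R :=
  if j is k.+1 then oapp (d 0) 0 (insub k) else 0.

Definition sum_all (R : realType) (N : nat) (d : 'rV[R]_N) : R :=
  \sum_(j < N) d 0 j.

(* d(I), where [i : 'I_N] stands for the index i + 1 of {1, ..., N}. *)
Definition sum_on (R : realType) (N : nat) (d : 'rV[R]_N) (I : {set 'I_N}) : R :=
  \sum_(i in I) d 0 i.

(* d[k, k'] *)
Definition sum_range (R : realType) (N : nat) (d : 'rV[R]_N) (k k' : nat) : R :=
  \sum_(k <= j < k'.+1) tcoord d j.

Definition weakly_decreasing (R : realType) (N : nat) (d : 'rV[R]_N) : Prop :=
  forall j : nat, (1 <= j < N)%N -> tcoord d j >= tcoord d j.+1.

Definition integral_tuple (R : realType) (N : nat) (d : 'rV[R]_N) : Prop :=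
  forall j : 'I_N, d 0 j \is a Num.int.

Definition trapezoid (n m : nat) : Type :=
  {ij : nat * nat | (ij.1 <= n)%N && (ij.2 <= ij.1 + m)%N}.

Definition trap_array (R : realType) (n m : nat) : Type := trapezoid n m -> R.

Section Arrays.
Variables (R : realType) (n m : nat).
Implicit Type X : trap_array R n m.

(* x_ij for (i, j) in the trapezoid, and a dummy 0 elsewhere. *)
Definition entry X (i j : nat) : R := oapp X 0 (insub (i, j)).

(* Meaningful for i <= n and 1 <= j <= i + m only. *)
Definition row_deriv X (i j : nat) : R := entry X i j - entry X i j.-1.

Definition strip_concave X : Prop :=
  forall i : nat, (1 <= i <= n)%N ->
    (forall j : nat, (1 <= j <= i.-1 + m)%N ->
       row_deriv X i j >= row_deriv X i.-1 j) /\
    (forall j : nat, (1 <= j <= (i + m).-1)%N ->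
       row_deriv X i.-1 j >= row_deriv X i j.+1).

Definition bd_lambda X : 'rV[R]_(n + m) := \row_(j < n + m) row_deriv X n j.+1.

Definition bd_lambdabar X : 'rV[R]_m := \row_(j < m) row_deriv X 0 j.+1.

Definition bd_mu X : 'rV[R]_n := \row_(i < n) (entry X i.+1 0 - entry X i 0).

Definition bd_nu X : 'rV[R]_n :=
  \row_(i < n) (entry X i.+1 (i.+1 + m)%N - entry X i (i + m)%N).

Definition has_boundary (lam : 'rV[R]_(n + m)) (lamb : 'rV[R]_m)
    (mu nu : 'rV[R]_n) X : Prop :=
  [/\ bd_lambda X = lam, bd_lambdabar X = lamb, bd_mu X = mu & bd_nu X = nu].

Definition SC : set (trap_array R n m) :=
  [set X | strip_concave X /\ entry X 0 0 = 0]%classic.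

Definition SC_boundary (lam : 'rV[R]_(n + m)) (lamb : 'rV[R]_m)
    (mu nu : 'rV[R]_n) : set (trap_array R n m) :=
  [set X | SC X /\ has_boundary lam lamb mu nu X]%classic.

Definition integral_array X : Prop :=
  forall v : trapezoid n m, X v \is a Num.int.

(* delta_k(j); since the subtraction j - k is truncated at 0, the test
   1 <= j - k fails exactly when it fails over the integers. *)
Definition deficit (lam : 'rV[R]_(n + m)) (lamb : 'rV[R]_m) (k j : nat) : R :=
  if (1 <= j - k <= m)%N then Num.max 0 (tcoord lamb (j - k) - tcoord lam j)
  else 0.

Definition total_deficit (lam : 'rV[R]_(n + m)) (lamb : 'rV[R]_m) (k : nat) : R :=
  \sum_(1 <= j < (n + m).+1) deficit lam lamb k j.

End Arrays.

(* Main.v *)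
Require Import Defs.
From HB Require Import structures.
From mathcomp Require Import all_boot all_order all_algebra.
From mathcomp Require Import classical_sets reals.
From mathcomp Require Import perm ring lra zify.

(** The rows of row derivatives of a strip-concave array form a skew
    Gelfand-Tsetlin pattern: row [i] has [i + m] parts, consecutive rows
    interlace, the bottom row is lambda-bar and the top row is lambda.  The
    entries of [mu] and [nu] only matter through the weights [nu_i - mu_i],
    which are the differences of consecutive row sums; conversely [mu] and a
    pattern of these weights determine the array.  So the question is which
    weight vectors occur between two given rows, and the answer is: the vectors
    majorized by the one of a greedy pattern.

    Necessity ([weight_le_strip_bound]).  The number
    lambda[1, k] - Delta_k is the largest amount that [k] interlacing steps can
    remove from lambda without going below lambda-bar.  That any [k] of the [n]
    steps have at most this total weight follows by adding one row at a time:
    the new row does not lower the bound for [k], and raises the bound for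
    [k + 1] above the old bound for [k] by at least the weight of the new step
    ([strip_bound_step]).

    Sufficiency ([attained_of_majorized]).  The greedy pattern, which from the
    top down removes as much as it can at every step, attains all these bounds
    at once.  Its weights are then moved to the prescribed ones by transfers,
    which bring two weights closer together (or exchange them) and keep their
    sum.
    - For two adjacent steps, only the row between them changes.  With its two
      neighbours fixed this row ranges over a product of intervals, and the
      reflection of the box about its centre exchanges the two weights, so all
      the intermediate values are attained as well ([middle_row],
      [attained_adjacent_transfer]).
    - Adjacent exchanges generate the transfers between arbitrary steps and all
      the permutations ([any_transfer], [perm_closed]).
    - A majorized vector is reached by finitely many transfers, each of which
      makes one more coordinate agree with the target: this is the theorem of
      Hardy, Littlewood and Polya ([sorted_majorization], [majorization]).

    Integrality.  Every construction only uses sums, differences, maxima and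
    minima of the data, so it stays inside any additive subgroup [S] of the
    scalars that contains them.  Taking all the scalars for [S] gives existence,
    and taking the integers gives integer points. *)

Set Implicit Arguments.
Unset Strict Implicit.
Unset Printing Implicit Defensive.

Import Order.TTheory GRing.Theory Num.Theory.
Local Open Scope ring_scope.

(** * Majorization by transfers *)

(** The Robin Hood operation of majorization theory, including the exchange of
    the two values, which makes it symmetric in [i] and [k]. *)
Definition transfer (R : realDomainType) (n : nat) (i k : 'I_n)
    (v w : 'I_n -> R) : Prop :=
  [/\ w i + w k = v i + v k,
      (v i <= w i <= v k) || (v k <= w i <= v i)
    & forall x, x != i -> x != k -> w x = v x].

Lemma sorting_perm (R : realDomainType) n (w : 'I_n -> R) :
  exists s : 'S_n, {homo w \o s : i k / (i <= k)%N >-> i <= k}.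
Proof.
pose t := [tuple w i | i < n].
have /tuple_permP[s sE] : perm_eq (sort <=%O t) t by rewrite perm_sort.
exists s => i k le_ik.
have nthE (x : 'I_n) : (w \o s) x = nth 0 (sort <=%O t) x.
  by rewrite sE -tnth_nth !tnth_mktuple.
rewrite !nthE; apply: (sorted_leq_nth le_trans lexx) => //.
- exact: sort_le_sorted.
- by rewrite inE size_sort size_tuple.
- by rewrite inE size_sort size_tuple.
Qed.

Section Transfers.
Variables (R : realDomainType) (S : zmodClosed R) (n : nat).
Implicit Types (v w : 'I_n -> R) (i k : 'I_n).

Lemma transfer_sym i k v w : transfer i k v w -> transfer k i v w.
Proof.
move=> [sum_eq between off]; split; last by move=> x xk xi; apply: off.
- lra.
- lra.
Qed.

(* [P] stands for the set of weight vectors of patterns with entries in [S]. *)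
Variable P : ('I_n -> R) -> Prop.
Hypothesis P_ext : forall v w, v =1 w -> P v -> P w.
Hypothesis P_in : forall v, P v -> forall i, v i \in S.
Hypothesis P_adj : forall i k v w, k = i.+1 :> nat ->
  transfer i k v w -> w i \in S -> P v -> P w.

(** Exchanging [k] with its left neighbour before and after the operation brings
    [k] one step closer to [i]. *)
Lemma distant_transfer i k v w : (i < k)%N ->
  transfer i k v w -> w i \in S -> P v -> P w.
Proof.
move=> ltik; have [d kE] : exists d, k = (i + d).+1 :> nat.
  by exists (k - i.+1)%N; lia.
elim: d k kE {ltik} v w => [|d IHd] k kE v w T Sw Pv.
  by apply: (P_adj _ T) => //; rewrite kE addn0.
have lt_k' : ((i + d).+1 < n)%N by rewrite (leq_ltn_trans _ (ltn_ord k)) // kE; lia.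
pose k' := Ordinal lt_k'.
have kk' : k = k'.+1 :> nat by rewrite kE /= addnS.
have k'k : k' != k by rewrite -val_eqE /=; lia.
have ik' : i != k' by rewrite -val_eqE /=; lia.
have ik : i != k by rewrite -val_eqE /=; lia.
have [sumT betT offT] := T.
have swapE (u : 'I_n -> R) : transfer k' k u (u \o tperm k' k).
  split=> [||x xk' xk] /=; rewrite ?tpermL ?tpermR ?tpermD // 1?eq_sym //; lra.
have Pv1 : P (v \o tperm k' k).
  by apply: (P_adj kk' (swapE v)) => //=; rewrite tpermL P_in.
have Pw1 : P (w \o tperm k' k).
  apply: (IHd k' erefl _ _ _ _ Pv1).
    split=> [||x xi xk'] /=; rewrite ?tpermL ?(tpermD (z := i)) // 1?eq_sym //.
    case: tpermP => [xE|_|_ /eqP xk]; last exact: offT.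
      by rewrite xE eqxx in xk'.
    by apply: offT; rewrite // eq_sym.
  by rewrite /= tpermD // eq_sym.
apply: P_ext (P_adj kk' (swapE _) _ Pw1).
  by move=> x /=; rewrite tpermK.
by rewrite /= tpermL tpermR offT ?P_in // eq_sym.
Qed.

Lemma any_transfer i k v w : i != k ->
  transfer i k v w -> w i \in S -> P v -> P w.
Proof.
rewrite -val_eqE neq_ltn => /orP[] lt_ik T Sw Pv.
  exact: distant_transfer lt_ik T Sw Pv.
apply: (distant_transfer lt_ik (transfer_sym T) _ Pv).
have [sumT _ _] := T.
have -> : w k = v i + v k - w i by rewrite -sumT addrC addKr.
apply: rpredB Sw; apply: rpredD; exact: P_in Pv _.
Qed.

(** A transposition is a transfer, the extreme one. *)
Lemma perm_closed v (s : 'S_n) : P v -> P (v \o s).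
Proof.
have [ts -> dts] := prod_tpermP s.
elim: ts dts v => [_|[x y] ts IHts /= /andP[xy dts]] v Pv.
  by rewrite big_nil; apply: P_ext Pv => x /=; rewrite perm1.
rewrite big_cons /=.
apply: P_ext (any_transfer xy (v := v \o (\prod_(t <- ts) tperm t.1 t.2)%g) _ _ _).
- by move=> z /=; rewrite permM.
- split=> [||z zx zy] /=; rewrite ?tpermL ?tpermR ?tpermD // 1?eq_sym //; lra.
- by rewrite /= P_in.
- exact: IHts.
Qed.

(** Hardy, Littlewood and Polya.  Take the first [k] where [v] is too large;
    the hypothesis on partial sums yields some [j < k] where [v] is too small.
    As [w] is sorted, [v j < w j <= w k < v k], so the smaller of the two gaps
    can be moved from [k] to [j], which closes one gap and opens none.  Before
    [k] all the gaps [w i - v i] are nonnegative, so the partial sums between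
    [j] and [k] have room for the amount moved. *)
Lemma sorted_majorization v w :
    (forall i, w i \in S) -> {homo w : i k / (i <= k)%N >-> i <= k} ->
    (forall p, \sum_(i < n | (i < p)%N) v i <= \sum_(i < n | (i < p)%N) w i) ->
    \sum_i v i = \sum_i w i ->
  P v -> P w.
Proof.
move=> Sw w_mono.
have [d] := ubnP #|[set i | v i != w i]|; elim: d v => // d IHd v le_d dom tot Pv.
have [k vwk | vw] := pickP [pred k | v k > w k]; last first.
  have ge0 i : 0 <= w i - v i by rewrite subr_ge0 leNgt; move: (vw i) => /= ->.
  apply: P_ext Pv => i; apply/esym/eqP; rewrite -subr_eq0; move: i.
  have /eqP : \sum_i (w i - v i) = 0 by rewrite sumrB tot subrr.
  by rewrite psumr_eq0 // => /allP h i; apply: (h i); rewrite mem_index_enum.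
have {k vwk} [k vwk k_min] :
    exists2 k, v k > w k & forall i, (i < k)%N -> v i <= w i.
  case: (arg_minnP (P := fun k => v k > w k) (@nat_of_ord n) vwk) => k0 vwk0 h.
  by exists k0 => // i; rewrite leNgt; apply: contraTN => /h; rewrite -leqNgt.
have [j /andP[ltjk vwj] | all_le] :=
    pickP [pred j : 'I_n | (j < k)%N && (v j < w j)]; last first.
  have := dom k.+1; rewrite leNgt => /negP[].
  rewrite !(bigD1 (P := fun i : 'I_n => (i < k.+1)%N) k) //=.
  rewrite ltr_leD // ler_sum // => i /andP[ik' ik].
  have ltik : (i < k)%N by move: ik' ik; rewrite -val_eqE /=; lia.
  by have /negbT := all_le i; rewrite /= ltik -leNgt.
have Sv := P_in Pv.
have jk : j != k by rewrite -val_eqE /=; lia.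
have le_w : w j <= w k by apply: w_mono; lia.
pose t := Num.min (w j - v j) (v k - w k).
have t_le : t <= w j - v j /\ t <= v k - w k by split; rewrite ge_min lexx ?orbT.
have t_gt0 : 0 < t by rewrite lt_min !subr_gt0 vwj.
have St : t \in S by rewrite /t; case: leP => _; rewrite rpredB.
pose u i := if i == j then v j + t else if i == k then v k - t else v i.
have uj : u j = v j + t by rewrite /u eqxx.
have uk : u k = v k - t by rewrite /u eq_sym (negPf jk) eqxx.
have u_off i : i != j -> i != k -> u i = v i by rewrite /u => /negPf-> /negPf->.
have Pu : P u.
  apply: (any_transfer jk) Pv; last by rewrite uj rpredD.
  split=> //; rewrite uj ?uk; lra.
have pick_sum (Q : pred 'I_n) x :
    \sum_(i | Q i) (if i == x then t else 0) = if Q x then t else 0.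
  case: ifP => Qx.
    by rewrite (bigD1 x) //= eqxx big1 ?addr0 // => i /andP[_ /negPf->].
  by rewrite big1 // => i Qi; case: eqP => // ix; rewrite ix Qx in Qi.
have u_sum (Q : pred 'I_n) : \sum_(i | Q i) u i =
    \sum_(i | Q i) v i + (if Q j then t else 0) - (if Q k then t else 0).
  rewrite -!pick_sum -big_split -sumrB; apply: eq_bigr => i _.
  rewrite /= /u; case: eqP => [->|_]; first by rewrite (negPf jk) subr0.
  by case: eqP => [->|_]; rewrite !(addr0, subr0).
apply: IHd Pu.
- suff /proper_card lt : [set i | u i != w i] \proper [set i | v i != w i].
    by apply: leq_trans lt _; rewrite -ltnS.
  apply/properP; split.
    apply/fintype.subsetP => i; rewrite !inE; apply: contraNneq => vwi.
    have ij : i != j by apply: contraTneq vwj => <-; rewrite vwi ltxx.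
    have ik : i != k by apply: contraTneq vwk => <-; rewrite vwi ltxx.
    by rewrite u_off ?vwi.
  have [tE|tE] : t = w j - v j \/ t = v k - w k by rewrite /t; case: leP; [left|right].
    exists j; first by rewrite inE lt_eqF.
    by rewrite inE negbK uj tE; apply/eqP; ring.
  exists k; first by rewrite inE gt_eqF.
  by rewrite inE negbK uk tE; apply/eqP; ring.
- move=> p; rewrite u_sum /=; case: (ltnP k p) => [ltkp|lepk].
    by rewrite (ltn_trans ltjk ltkp) addrK dom.
  rewrite subr0; case: (ltnP j p) => [ltjp|_]; last by rewrite addr0 dom.
  rewrite !(bigD1 (P := fun i : 'I_n => (i < p)%N) j) //=.
  have : \sum_(i < n | (i < p)%N && (i != j)) v i <=
      \sum_(i < n | (i < p)%N && (i != j)) w i.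
    by apply: ler_sum => i /andP[ip _]; apply: k_min; apply: leq_trans lepk.
  lra.
- by rewrite -tot (u_sum predT) /= addrK.
Qed.

(** Only the partial sums of [v] in the given order are compared with the sums
    of [w] over all sets of the same size: this is enough since the sorted
    rearrangement of [w] minimizes such sums on its initial segments, and it
    avoids sorting [v]. *)
Lemma majorization v w :
    (forall i, w i \in S) ->
    (forall I : {set 'I_n}, \sum_(i < n | (i < #|I|)%N) v i <= \sum_(i in I) w i) ->
    \sum_i v i = \sum_i w i ->
  P v -> P w.
Proof.
move=> Sw dom tot Pv; have [s w_mono] := sorting_perm w.
apply: P_ext (perm_closed (v := w \o s) s^-1%g _).
  by move=> i /=; rewrite permKV.
apply: sorted_majorization w_mono _ _ Pv; first by move=> i; apply: Sw.
  move=> p; have [le_np|lt_pn] := leqP n p.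
    have all_lt (i : 'I_n) : (i < p)%N = true by apply: leq_trans le_np.
    rewrite !(eq_bigl predT) // tot (reindex_inj (@perm_inj _ s)) /=.
    exact: lexx.
  have card_p : #|[set i : 'I_n | (i < p)%N]| = p.
    by rewrite -sum1dep_card (big_ord_narrow (ltnW lt_pn)) sum_nat_const card_ord muln1.
  have := dom (s @: [set i : 'I_n | (i < p)%N]).
  rewrite card_imset; last exact: perm_inj.
  rewrite card_p big_imset /=; last by move=> x y _ _; apply: perm_inj.
  by under [X in _ <= X]eq_bigl => i do rewrite inE.
by rewrite tot (reindex_inj (@perm_inj _ s)).
Qed.

End Transfers.

(** * Patterns of interlacing rows *)

Section Patterns.
Variable R : realDomainType.
Implicit Types (a b c lo hi lam lamb : nat -> R) (L : nat -> nat -> R).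

Definition interlaces N a c := forall j, (j < N)%N -> a j.+1 <= c j <= a j.

Definition gt_pattern n m lam lamb L : Prop :=
  [/\ forall i, (i < n)%N -> interlaces (i + m) (L i.+1) (L i),
      forall j, (j < n + m)%N -> L n j = lam j
    & forall j, (j < m)%N -> L 0%N j = lamb j].

Definition weight m L i := \sum_(j < i.+1 + m) L i.+1 j - \sum_(j < i + m) L i j.

(** This is lambda[1, k] - Delta_k, or also the sum of the parts of [lam] minus
    that of the maxima of [lamb] and of [lam] shifted by [k] places, the lowest
    row that [k] interlacing steps below [lam] allow above [lamb]. *)
Definition strip_bound m lam lamb k :=
  \sum_(j < k) lam j - \sum_(j < m) Num.max 0 (lamb j - lam (j + k)%N).

Definition attained (S : {pred R}) n m lam lamb (w : 'I_n -> R) : Prop :=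
  exists L, [/\ gt_pattern n m lam lamb L,
    forall i j, (i <= n)%N -> (j < i + m)%N -> L i j \in S
    & forall i : 'I_n, weight m L i = w i].

(** The second bound holds because the drops [e j = kap j - lam j.+1] are
    nonnegative: the weight of the step is [lam 0] minus the sum of all of them,
    the first [k] drops pay for the change from [kap] to [lam] in the leading
    sum, the next [m] ones for the change of the deficits. *)
Lemma strip_bound_step N m lam lamb kap k :
    (k + m <= N)%N -> interlaces N lam kap ->
  strip_bound m kap lamb k <= strip_bound m lam lamb k /\
  \sum_(j < N.+1) lam j - \sum_(j < N) kap j + strip_bound m kap lamb k
    <= strip_bound m lam lamb k.+1.
Proof.
move=> le_N il; split.
  apply: lerB; apply: ler_sum => j _.
    by have /il/andP[] : (j < N)%N by have := ltn_ord j; lia.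
  rewrite ge_max le_max lexx le_max lerB ?orbT //.
  by have /il/andP[] : (j + k < N)%N by have := ltn_ord j; lia.
pose e j := kap j - lam j.+1.
have e_ge0 j : (j < N)%N -> 0 <= e j by move=> /il/andP[]; rewrite subr_ge0.
have bracket : \sum_(j < m) Num.max 0 (lamb j - lam (j + k.+1)%N)
    - \sum_(j < m) Num.max 0 (lamb j - kap (j + k)%N) <= \sum_(j < m) e (j + k)%N.
  rewrite -sumrB; apply: ler_sum => j _.
  have := e_ge0 (j + k)%N; rewrite /e addnS.
  have -> : (j + k < N)%N by have := ltn_ord j; lia.
  move=> /(_ isT) e_jk.
  set x := _ - lam _; set y := _ - kap _.
  have xy : kap (j + k)%N - lam (j + k).+1 = x - y by rewrite /x /y; ring.
  by rewrite xy in e_jk *; case: (leP 0 x) => ?; case: (leP 0 y) => ?; lra.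
have e_split : \sum_(j < k) e j + \sum_(j < m) e (j + k)%N <= \sum_(j < N) e j.
  rewrite -(subnKC le_N) big_split_ord big_split_ord /=.
  under [\sum_(j < m) e (k + j)%N]eq_bigr => j _ do rewrite addnC.
  rewrite -[leLHS]addr0 lerD2l sumr_ge0 // => j _; apply: e_ge0.
  by have := ltn_ord j; lia.
move: e_split bracket; rewrite /strip_bound !big_ord_recl /= !sumrB.
rewrite /bump /=; under [\sum_(i < k) lam (1 + i)%N]eq_bigr => j _ do rewrite add1n.
under [\sum_(i < N) lam (1 + i)%N]eq_bigr => j _ do rewrite add1n.
lra.
Qed.

Lemma weight_le_strip_bound n m L lamb (A : pred nat) :
    (forall i, (i < n)%N -> interlaces (i + m) (L i.+1) (L i)) ->
    (forall j, (j < m)%N -> L 0%N j = lamb j) ->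
  \sum_(i < n | A i) weight m L i <= strip_bound m (L n) lamb (\sum_(i < n) A i).
Proof.
move=> + L0; elim: n => [|n IHn] il.
  rewrite !big_ord0 /strip_bound big_ord0 big1 ?subrr // => j _.
  by rewrite addn0 L0 // subrr maxxx.
have {}IHn := IHn (fun i lt_in => il i (ltnW lt_in)).
rewrite big_mkcond !big_ord_recr -big_mkcond /=.
have le_k : (\sum_(i < n) A i <= n)%N.
  by rewrite -[leqRHS]card_ord -sum1_card leq_sum // => i _; case: (A i).
have [|le0 le1] :=
  strip_bound_step (m := m) (k := \sum_(i < n) A i) lamb _ (il n (ltnSn n)).
  by rewrite leq_add2r.
case: (A n); last by rewrite addn0 addr0; apply: le_trans le0.
rewrite addn1 /weight; apply: le_trans le1.
by rewrite addrC lerD2l.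
Qed.

(** The last coordinate is taken as large as possible, which leaves the least
    for the other ones. *)
Lemma box_sum (S : zmodClosed R) N lo hi sigma :
    (forall j, (j < N)%N -> [/\ lo j <= hi j, lo j \in S & hi j \in S]) ->
    sigma \in S -> \sum_(j < N) lo j <= sigma <= \sum_(j < N) hi j ->
  exists c, (forall j, (j < N)%N -> lo j <= c j <= hi j /\ c j \in S) /\
    \sum_(j < N) c j = sigma.
Proof.
elim: N sigma => [|N IHN] sigma box Ssig.
  rewrite !big_ord0 => ?; exists lo; rewrite big_ord0; split=> //.
  by apply/eqP; rewrite eq_le.
rewrite !big_ord_recr /= => /andP[le_lo le_hi].
have [lohi Slo Shi] := box N (ltnSn N).
have Slos : \sum_(j < N) lo j \in S.
  by apply: rpred_sum => j _; case: (box j (ltnW (ltn_ord j))).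
pose x := Num.min (hi N) (sigma - \sum_(j < N) lo j).
have Sx : x \in S by rewrite /x; case: leP => // _; apply: rpredB.
have [|||c [c_box c_sum]] := IHN (sigma - x).
- by move=> j ltj; apply: box; apply: ltnW.
- exact: rpredB.
- have : \sum_(j < N) lo j <= \sum_(j < N) hi j.
    by apply: ler_sum => j _; case: (box j (ltnW (ltn_ord j))).
  by rewrite /x; case: (leP (hi N)) => ? ?; lra.
exists (fun j => if j == N then x else c j); split.
  move=> j; case: eqP => [-> _|neq]; last by move=> ltj; apply: c_box; lia.
  by split=> //; rewrite /x; case: (leP (hi N)) => ?; lra.
rewrite big_ord_recr /= eqxx; under eq_bigr => j _ do rewrite ltn_eqF //.
by rewrite c_sum subrK.
Qed.

(** Given its neighbours, a row ranges over a box, between [lo] and [hi] in each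
    coordinate.  The sums of [lo] and [hi] add up to those of [a] and [b], since
    a maximum and a minimum of the same two numbers add up to their sum.  So the
    box contains a row with the sum [t] of the reflection of [c], and rows with
    all the sums in between. *)
Lemma middle_row (S : zmodClosed R) N a b c sigma :
    (forall j, (j < N.+2)%N -> a j \in S) -> (forall j, (j < N)%N -> b j \in S) ->
    interlaces N.+1 a c -> interlaces N c b -> sigma \in S ->
    let s := \sum_(j < N.+1) c j in
    let t := \sum_(j < N.+2) a j + \sum_(j < N) b j - s in
    (s <= sigma <= t) || (t <= sigma <= s) ->
  exists d, [/\ interlaces N.+1 a d, interlaces N d b,
    forall j, (j < N.+1)%N -> d j \in S & \sum_(j < N.+1) d j = sigma].
Proof.
move=> Sa Sb ac cb Ssig s t between.
(* [b] bounds the row from below except in the last coordinate, and from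
   above except in the first one. *)
pose lo j := if (j < N)%N then Num.max (a j.+1) (b j) else a j.+1.
pose hi j := if j is j'.+1 then Num.min (a j'.+1) (b j') else a 0%N.
have c_box j : (j < N.+1)%N -> lo j <= c j <= hi j.
  move=> ltj; have /andP[ac1 ac2] := ac j ltj; apply/andP; split.
    rewrite /lo; case: ifP => // ltjN; rewrite ge_max ac1.
    by have /andP[] := cb j ltjN.
  case: j ltj ac1 ac2 => //= j ltj _ ac2; rewrite le_min ac2.
  by have /andP[] := cb j ltj.
have sum_box : \sum_(j < N.+1) lo j + \sum_(j < N.+1) hi j = s + t.
  rewrite big_ord_recr [\sum_(j < N.+1) hi j]big_ord_recl /= /lo ltnn.
  have -> : s + t = a 0%N + (\sum_(j < N) a j.+1 + a N.+1) + \sum_(j < N) b j.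
    by rewrite /t addrC subrK big_ord_recl big_ord_recr.
  have -> : \sum_(i < N) (if (i < N)%N then Num.max (a i.+1) (b i) else a i.+1)
     = \sum_(i < N) (a i.+1 + b i - Num.min (a i.+1) (b i)).
    by apply: eq_bigr => i _; rewrite ltn_ord; case: leP => _; ring.
  rewrite sumrB big_split /=; ring.
have [le_lo le_hi] : \sum_(j < N.+1) lo j <= s /\ s <= \sum_(j < N.+1) hi j.
  by split; apply: ler_sum => j _; case/andP: (c_box j (ltn_ord j)).
have [|//||d [d_box d_sum]] := @box_sum S N.+1 lo hi sigma.
- move=> j ltj; split.
  + by case/andP: (c_box j ltj) => ? ?; lra.
  + rewrite /lo; case: ifP => ltjN; last exact: Sa.
    by case: leP => _; [apply: Sb|apply: Sa].
  + case: j ltj => [|j] ltj /=; first exact: Sa.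
    by case: leP => _; [apply: Sa; lia|apply: Sb].
- by move: between; case/orP => /andP[? ?]; apply/andP; split; lra.
exists d; split=> // [j ltj|j ltj|j ltj].
- have [/andP[dlo dhi] _] := d_box j ltj; apply/andP; split.
    by move: dlo; rewrite /lo; case: ifP => // _; rewrite ge_max => /andP[].
  by case: j {ltj dlo} dhi => //= j; rewrite le_min => /andP[].
- have [/andP[dlo _] _] := d_box j (ltnW ltj).
  have [/andP[_ dhi] _] := d_box j.+1 ltj.
  by move: dlo dhi; rewrite /lo /= ltj ge_max le_min => /andP[_ ->] /andP[_ ->].
- by have [] := d_box j ltj.
Qed.

Lemma attained_adjacent_transfer (S : zmodClosed R) n m lam lamb
    (i k : 'I_n) (v w : 'I_n -> R) :
    k = i.+1 :> nat -> transfer i k v w -> w i \in S ->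
  attained S m lam lamb v -> attained S m lam lamb w.
Proof.
move=> kE [sumw between off] Swi [L [[il Ln L0] SL Lw]].
have lt_n : (i.+1 < n)%N by rewrite -kE.
have wi := Lw i; have wk := Lw k; rewrite /weight kE in wi wk.
have Sb j : (j < i + m)%N -> L i j \in S by move=> ?; apply: SL => //; lia.
have Sa j : (j < i.+2 + m)%N -> L i.+2 j \in S by move=> ?; apply: SL => //; lia.
(* The sum that row [i.+1] needs for step [i] to have weight [w i]. *)
pose sigma := \sum_(j < i + m) L i j + w i.
have [||d [ad db Sd d_sum]] := @middle_row S (i + m) (L i.+2) (L i) (L i.+1) sigma
    Sa Sb (il i.+1 lt_n) (il i (ltnW lt_n)).
  by apply: rpredD => //; apply: rpred_sum => j _; apply: Sb.
  move: between wi wk; rewrite !addSn /sigma => /orP between wi wk.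
  by apply/orP; case: between => /andP[? ?]; [left|right]; apply/andP; split; lra.
exists (fun r => if r == i.+1 then d else L r); split; first split.
- move=> r lt_r; case: (eqVneq r.+1 i.+1) => [[rE]|ne1].
    by rewrite rE ltn_eqF.
  by case: eqVneq => [->|ne2] //; apply: il.
- by move=> j ltj; rewrite gtn_eqF // Ln.
- exact: L0.
- move=> r j ler ltj; case: eqVneq ltj => [->|ne] ltj; last exact: SL.
  exact: Sd.
- move=> r.
  have [->|ri] := eqVneq r i.
    by rewrite /weight eqxx ltn_eqF // d_sum /sigma; ring.
  have [->|rk] := eqVneq r k.
    rewrite /weight kE eqxx gtn_eqF // !addSn d_sum /sigma.
    move: wi wk sumw; rewrite !addSn; lra.
  rewrite off // -Lw /weight; move: ri rk; rewrite -!val_eqE /= kE => ri rk.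
  by rewrite eqSS (negPf ri) (negPf rk).
Qed.

End Patterns.

(** * The greedy pattern *)

Section Existence.
Variables (R : realDomainType) (S : zmodClosed R) (n m : nat).
Variables lam lamb : nat -> R.
Hypothesis lam_anti : forall j, (j.+1 < n + m)%N -> lam j.+1 <= lam j.
Hypothesis lamb_anti : forall j, (j.+1 < m)%N -> lamb j.+1 <= lamb j.
Hypothesis Slam : forall j, (j < n + m)%N -> lam j \in S.
Hypothesis Slamb : forall j, (j < m)%N -> lamb j \in S.

(** The lowest row above [lamb] that [n - i] interlacing steps below [lam]
    allow. *)
Definition greedy i j : R :=
  if (j < m)%N then Num.max (lam (j + (n - i))%N) (lamb j) else lam (j + (n - i))%N.

Lemma greedy_sum i : (i <= n)%N ->
  \sum_(j < i + m) greedy i j =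
    \sum_(j < n + m) lam j - strip_bound m lam lamb (n - i).
Proof.
move=> le_in; have -> : (n + m = (n - i) + (i + m))%N by lia.
rewrite /strip_bound [\sum_(j < n - i + _) _]big_split_ord /=.
have -> : \sum_(j < i + m) greedy i j = \sum_(j < i + m) lam (n - i + j)%N
    + \sum_(j < m) Num.max 0 (lamb j - lam (j + (n - i))%N).
  rewrite (addnC i) !big_split_ord /= addrAC -big_split /=; congr (_ + _).
    apply: eq_bigr => j _; rewrite /greedy ltn_ord [in RHS](addnC (n - i)%N).
    by case: (leP (lam _)) => ?; case: (leP 0) => ?; lra.
  apply: eq_bigr => j _.
  by rewrite /greedy ltnNge leq_addr /= [in RHS](addnC (n - i)%N).
ring.
Qed.

(** The hypotheses are what the interlacing needs at the two ends, where the
    maximum must reduce to [lam] and to [lamb]. *)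
Lemma greedy_pattern :
    (forall j, (j < m)%N -> lamb j <= lam j) ->
    (forall j, (j < m)%N -> lam (j + n)%N <= lamb j) ->
  gt_pattern n m lam lamb greedy.
Proof.
move=> lamb_le lam_le; split=> [i lt_in j ltj|j ltj|j ltj].
- rewrite /greedy; have -> : (j + (n - i) = (j + (n - i.+1)).+1)%N by lia.
  have -> : (j.+1 + (n - i.+1) = (j + (n - i.+1)).+1)%N by lia.
  have lam_j : lam (j + (n - i.+1)).+1 <= lam (j + (n - i.+1))%N.
    by apply: lam_anti; lia.
  case: (ltnP j.+1 m) => [ltj1|lej1].
    rewrite ltnW //; apply/andP; split.
      by rewrite ge_max !le_max lexx lamb_anti ?orbT.
    by rewrite ge_max !le_max lam_j lexx orbT.
  case: ltnP => [ltjm|lejm]; last by rewrite lexx.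
  by rewrite le_max lexx /= ge_max !le_max lam_j lexx orbT.
- rewrite /greedy subnn addn0; case: ltnP => // ltjm.
  by apply/max_idPl; apply: lamb_le.
- by rewrite /greedy ltj subn0; apply/max_idPr; apply: lam_le.
Qed.

(** The bounds for the empty and for the full set say that sums of nonnegative
    terms are at most 0; their vanishing gives the two hypotheses of
    [greedy_pattern].  The remaining bounds are turned by complementation into
    lower bounds for [w], to be compared with the initial weights of the greedy
    pattern, which telescope. *)
Lemma attained_of_majorized (w : 'I_n -> R) :
    (forall i, w i \in S) ->
    \sum_i w i = \sum_(j < n + m) lam j - \sum_(j < m) lamb j ->
    (forall I : {set 'I_n}, \sum_(i in I) w i <= strip_bound m lam lamb #|I|) ->
  attained S m lam lamb w.
Proof.
move=> Sw w_sum w_le.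
have lamb_le j : (j < m)%N -> lamb j <= lam j.
  have := w_le finset.set0; rewrite finset.big_set0 cards0 /strip_bound big_ord0 sub0r.
  rewrite oppr_ge0 => le0.
  have : \sum_(j < m) Num.max 0 (lamb j - lam (j + 0)%N) == 0.
    by rewrite eq_le le0 sumr_ge0 // => i _; rewrite le_max lexx.
  rewrite psumr_eq0 => [/allP eq0 ltj|i _]; last by rewrite le_max lexx.
  have := eq0 (Ordinal ltj) (mem_index_enum _); rewrite /= addn0.
  by case: (leP 0) => ? /eqP ?; lra.
have lam_le j : (j < m)%N -> lam (j + n)%N <= lamb j.
  have := w_le finset.setT; rewrite cardsT card_ord big_set /= w_sum /strip_bound.
  rewrite big_split_ord /= => le0.
  have : \sum_(j < m)
      (Num.max 0 (lamb j - lam (j + n)%N) - (lamb j - lam (j + n)%N)) == 0.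
    rewrite eq_le sumr_ge0 => [|i _]; last by rewrite subr_ge0 le_max lexx orbT.
    rewrite !sumrB andbT; move: le0.
    under [\sum_(i < m) lam (n + i)%N]eq_bigr => i _ do rewrite addnC.
    lra.
  rewrite psumr_eq0 => [/allP eq0 ltj|i _].
    have := eq0 (Ordinal ltj) (mem_index_enum _); rewrite /=.
    by case: (leP 0) => ? /eqP ?; lra.
  by rewrite subr_ge0 le_max lexx orbT.
have gtg := greedy_pattern lamb_le lam_le.
have weight_sum p : (p <= n)%N -> \sum_(i < n | (i < p)%N) weight m greedy i =
    \sum_(j < p + m) greedy p j - \sum_(j < m) lamb j.
  move=> le_pn; rewrite (big_ord_narrow le_pn) /=.
  rewrite -(big_mkord predT (weight m greedy)) telescope_sumr //=.
  congr (_ - _); apply: eq_bigr => j _.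
  by have [_ _ ->] := gtg.
have Sgreedy i j : (i <= n)%N -> (j < i + m)%N -> greedy i j \in S.
  move=> le_in ltj; rewrite /greedy; case: ifP => [ltjm|_]; last by apply: Slam; lia.
  by case: leP => _; [apply: Slamb|apply: Slam; lia].
apply: (@majorization _ S n (attained S m lam lamb) _ _ _ (fun i => weight m greedy i) w).
- by move=> v u vu [L [? ? Lv]]; exists L; split=> // i; rewrite Lv.
- move=> v [L [_ SL Lv]] i; rewrite -Lv /weight.
  by apply: rpredB; apply: rpred_sum => j _; apply: SL => //; apply: ltnW.
- by move=> i k v u; apply: attained_adjacent_transfer.
- exact: Sw.
- move=> I; have le_In : (#|I| <= n)%N by rewrite -[leqRHS]card_ord max_card.
  rewrite weight_sum // greedy_sum //.
  have coE : \sum_(i in ~: I) w i = \sum_(i | i \notin I) w i.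
    by apply: eq_bigl => i; rewrite inE.
  have := w_le (~: I); rewrite coE cardsCs finset.setCK card_ord.
  have := w_sum; rewrite (bigID (mem I)) /=.
  by move=> ? ?; lra.
- rewrite w_sum; have := weight_sum n (leqnn n).
  under eq_bigl => i do rewrite ltn_ord.
  move=> ->; congr (_ - _); apply: eq_bigr => j _.
  by have [_ -> //] := gtg; apply: ltn_ord.
- by exists greedy.
Qed.

End Existence.

(** * Trapezoidal arrays *)

(** All the scalars form an additive subgroup; this is the choice of [S] that
    leaves the entries unrestricted. *)
HB.instance Definition _ (V : zmodType) :=
  GRing.isZmodClosed.Build V (predT : {pred V}) (conj isT (fun _ _ _ _ => isT)).

Section Arrays.
Variables (R : realType) (n m : nat).
Implicit Types (X : trap_array R n m) (mu nu : 'rV[R]_n).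

(** The coordinates are renumbered from 0, as rows of patterns are. *)
Definition parts N (d : 'rV[R]_N) (j : nat) : R := tcoord d j.+1.

Lemma partsE N (d : 'rV[R]_N) (j : 'I_N) : parts d j = d 0 j.
Proof. by rewrite /parts /tcoord valK. Qed.

Lemma sum_parts N (d : 'rV[R]_N) : \sum_(j < N) parts d j = sum_all d.
Proof. by apply: eq_bigr => j _; rewrite partsE. Qed.

Lemma parts_in (S : {pred R}) N (d : 'rV[R]_N) :
  (forall j, d 0 j \in S) -> forall j, (j < N)%N -> parts d j \in S.
Proof. by move=> Sd j ltj; rewrite (partsE d (Ordinal ltj)). Qed.

Lemma parts_anti N (d : 'rV[R]_N) : weakly_decreasing d ->
  forall j, (j.+1 < N)%N -> parts d j.+1 <= parts d j.
Proof. by move=> d_anti j ltj; apply: d_anti. Qed.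

(** The index [j] of the deficits is shifted by [k]; the terms with [j <= k] or
    [j > k + m] vanish by the test in their definition. *)
Lemma strip_boundE (lam : 'rV[R]_(n + m)) (lamb : 'rV[R]_m) k : (k <= n)%N ->
  sum_range lam 1 k - total_deficit lam lamb k =
    strip_bound m (parts lam) (parts lamb) k.
Proof.
move=> le_kn; rewrite /sum_range /total_deficit !big_add1 /= !big_mkord.
have split_sum (F : nat -> R) : \sum_(j < n + m) F j =
    \sum_(j < k) F j +
      (\sum_(j < m) F (k + j)%N + \sum_(j < n - k) F (k + (m + j))%N).
  have -> : (n + m = k + (m + (n - k)))%N by lia.
  by rewrite !big_split_ord.
rewrite (split_sum (fun j => deficit lam lamb k j.+1)).
congr (_ - _); rewrite big1 ?add0r => [|j _]; last first.
  rewrite /deficit; by case: ifP => // range; have := ltn_ord j; lia.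
rewrite [X in _ + X]big1 ?addr0 => [|j _]; last first.
  rewrite /deficit; by case: ifP => // range; lia.
apply: eq_bigr => j _; rewrite /deficit ifT; last by have := ltn_ord j; lia.
by rewrite /parts (addnC k) -addSn addnK.
Qed.

Lemma row_deriv_sum X i N :
  \sum_(j < N) row_deriv X i j.+1 = entry X i N - entry X i 0.
Proof.
by rewrite -(big_mkord predT (fun j => row_deriv X i j.+1)) telescope_sumr.
Qed.

Lemma pattern_of_array (lam : 'rV[R]_(n + m)) (lamb : 'rV[R]_m) mu nu X :
    strip_concave X -> has_boundary lam lamb mu nu X ->
  let L i j := row_deriv X i j.+1 in
  gt_pattern n m (parts lam) (parts lamb) L /\
  forall i : 'I_n, weight m L i = nu 0 i - mu 0 i.
Proof.
move=> X_sc [<- <- <- <-] L; split; last first.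
  by move=> i; rewrite /weight !row_deriv_sum !mxE; ring.
split=> [i lt_in j ltj|j ltj|j ltj].
- have [//|up down] := X_sc i.+1.
  by apply/andP; split; [apply: down|apply: up]; rewrite /=; lia.
- by rewrite (partsE _ (Ordinal ltj)) mxE.
- by rewrite (partsE _ (Ordinal ltj)) mxE.
Qed.

(** An entry is the sum of the steps [mu] up the left side and of the parts
    along its row. *)
Lemma array_of_pattern (S : zmodClosed R) (lam : 'rV[R]_(n + m))
    (lamb : 'rV[R]_m) mu nu :
    (forall i, mu 0 i \in S) ->
    attained S m (parts lam) (parts lamb) (fun i => nu 0 i - mu 0 i) ->
  exists X, SC_boundary lam lamb mu nu X /\ forall v, X v \in S.
Proof.
move=> Smu [L [[il Ln L0] SL Lw]].
pose x i j := \sum_(r < i) parts mu r + \sum_(c < j) L i c.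
pose X : trap_array R n m := fun v => x (val v).1 (val v).2.
have entryE i j : (i <= n)%N -> (j <= i + m)%N -> entry X i j = x i j.
  move=> le_in le_j; rewrite /entry.
  rewrite (insubT (fun ij : nat * nat => (ij.1 <= n)%N && (ij.2 <= ij.1 + m)%N)) //.
  by rewrite /= le_in.
have derivE i j : (i <= n)%N -> (j < i + m)%N -> row_deriv X i j.+1 = L i j.
  move=> le_in le_j; rewrite /row_deriv !entryE //=; last exact: ltnW.
  by rewrite /x big_ord_recr /=; ring.
exists X; split; last first.
  case=> [[i j] /= ok]; have /andP[le_in le_j] := ok; rewrite /X /x /=.
  apply: rpredD; apply: rpred_sum => r _.
    by apply: parts_in => //; apply: leq_trans le_in.
  by apply: SL => //; apply: leq_trans le_j.
split; first split.
- case=> [//|i] /= lt_in; have le_in := ltnW lt_in.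
  split=> j; case: j => // j le_j; have lt_j : (j < i + m)%N by lia.
    have lt_j' : (j < i.+1 + m)%N by lia.
    by rewrite !derivE //; have /andP[] := il i lt_in j lt_j.
  have lt_j' : (j.+1 < i.+1 + m)%N by lia.
  by rewrite !derivE //; have /andP[] := il i lt_in j lt_j.
- by rewrite entryE // /x !big_ord0 addr0.
- have wE (i : 'I_n) := Lw i.
  split; apply/rowP => j; rewrite mxE.
  + by rewrite derivE // Ln // partsE.
  + by rewrite derivE // L0 // partsE.
  + rewrite !entryE // ?(ltnW (ltn_ord j)) // /x !big_ord0 big_ord_recr /= partsE.
    by ring.
  + rewrite !entryE // ?(ltnW (ltn_ord j)) // /x big_ord_recr /= partsE.
    by have := wE j; rewrite /weight; lra.
Qed.

End Arrays.

Theorem theorem1 (R : realType) (n m : nat) (hn : (1 <= n)%N)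
    (lam : 'rV[R]_(n + m)) (lamb : 'rV[R]_m) (mu nu : 'rV[R]_n)
    (hlam : weakly_decreasing lam) (hlamb : weakly_decreasing lamb)
    (hsum : sum_all lam - sum_all lamb + sum_all mu - sum_all nu = 0) :
  ((exists X : trap_array R n m,
      strip_concave X /\ has_boundary lam lamb mu nu X) <->
   (forall I : {set 'I_n},
      sum_range lam 1 #|I| + sum_on mu I - sum_on nu I
        - total_deficit lam lamb #|I| >= 0)) /\
  (integral_tuple lam -> integral_tuple lamb ->
   integral_tuple mu -> integral_tuple nu ->
   (SC_boundary lam lamb mu nu !=set0)%classic ->
   exists X : trap_array R n m,
     SC_boundary lam lamb mu nu X /\ integral_array X).
Proof.
have condE (I : {set 'I_n}) :
    (sum_range lam 1 #|I| + sum_on mu I - sum_on nu I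
      - total_deficit lam lamb #|I| >= 0) =
    (\sum_(i in I) (nu 0 i - mu 0 i)
       <= strip_bound m (parts lam) (parts lamb) #|I|).
  rewrite -strip_boundE; last by rewrite -[leqRHS]card_ord max_card.
  by rewrite sumrB -[RHS]subr_ge0 /sum_on; congr (_ <= _); ring.
have necessary X : strip_concave X -> has_boundary lam lamb mu nu X ->
    forall I : {set 'I_n}, \sum_(i in I) (nu 0 i - mu 0 i)
      <= strip_bound m (parts lam) (parts lamb) #|I|.
  move=> X_sc X_bd I; have [[il Ln L0] Lw] := pattern_of_array X_sc X_bd.
  have le_In : (#|I| <= n)%N by rewrite -[leqRHS]card_ord max_card.
  pose A := [pred r | oapp (mem I) false (insub r)].
  have AE (i : 'I_n) : A i = (i \in I) by rewrite /A /= valK.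
  have A_card : (\sum_(i < n) A i = #|I|)%N.
    by rewrite -sum1_card [RHS]big_mkcond; apply: eq_bigr => i _; rewrite AE; case: ifP.
  have := weight_le_strip_bound A il L0; rewrite A_card; congr (_ <= _).
    by apply: eq_big => // i _; rewrite Lw.
  rewrite /strip_bound; congr (_ - _); apply: eq_bigr => j _; rewrite Ln //.
    by have := ltn_ord j; lia.
  by have := ltn_ord j; lia.
have sufficient (S : zmodClosed R) :
    (forall j, lam 0 j \in S) -> (forall j, lamb 0 j \in S) ->
    (forall i, mu 0 i \in S) -> (forall i, nu 0 i \in S) ->
    (forall I : {set 'I_n}, \sum_(i in I) (nu 0 i - mu 0 i)
      <= strip_bound m (parts lam) (parts lamb) #|I|) ->
    exists X, SC_boundary lam lamb mu nu X /\ forall v, X v \in S.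
  move=> Slam Slamb Smu Snu le_bound; apply: array_of_pattern => //.
  apply: attained_of_majorized => //; try exact: parts_anti; try exact: parts_in.
    by move=> i; apply: rpredB.
  by rewrite sumrB !sum_parts; move: hsum; rewrite /sum_all; lra.
split; first split.
- by move=> [X [X_sc X_bd]] I; rewrite condE; apply: necessary X_sc X_bd _.
- move=> cond; have [||||I|X [[[X_sc _] X_bd] _]] :=
    sufficient (GRing.ZmodClosed.clone R predT _) => //.
    by rewrite -condE.
  by exists X.
- move=> Zlam Zlamb Zmu Znu [X [[X_sc _] X_bd]].
  apply: (sufficient (GRing.ZmodClosed.clone R Num.int_num_subdef _)) => //.
  exact: necessary X_sc X_bd.
Qed.
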